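(* Let $n\in\mathbb{N}\setminus\{0\}$ and, for each $i\in\{1,\dots,n\}$, let $(X_i,d_i,W_i)$ be a $W$-hyperbolic space. Put $X:=\prod_{i=1}^n X_i$ and, for $x=(x_1,\dots,x_n)$, $y=(y_1,\dots,y_n)\in X$ and $\lambda\in[0,1]$, define $d(x,y):=\left(\sum_{i=1}^n d_i^2(x_i,y_i)\right)^{1/2}$ and $W(x,y,\lambda):=(W_1(x_1,y_1,\lambda),\dots,W_n(x_n,y_n,\lambda))$. Then $(X,d,W)$ is a $W$-hyperbolic space.
   Context: A $W$-hyperbolic space is a triple $(X,d,W)$ where $(X,d)$ is a metric space and $W:X^2\times[0,1]\to X$ is such that, for all $x,y,z,w\in X$ and $\lambda,\mu\in[0,1]$: (W1) $d(z,W(x,y,\lambda))\le(1-\lambda)d(z,x)+\lambda d(z,y)$; (W2) $d(W(x,y,\lambda),W(x,y,\mu))=|\lambda-\mu|d(x,y)$; (W3) $W(x,y,\lambda)=W(y,x,1-\lambda)$; (W4) $d(W(x,z,\lambda),W(y,w,\lambda))\le(1-\lambda)d(x,y)+\lambda d(z,w)$. Notation: $d^2(x,y)$ means $(d(x,y))^2$. *)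

(* Defs.v *)
From HB Require Import structures.
From mathcomp Require Import all_boot all_order all_algebra.
From mathcomp Require Import all_classical all_reals interval_inference topology.

Set Implicit Arguments.
Unset Strict Implicit.
Unset Printing Implicit Defensive.

Import Order.TTheory GRing.Theory Num.Theory.
Local Open Scope ring_scope.

(* The distance is an explicit argument rather than the [mdist] of a
   [metricType]: [X] carries no topology here, and the product below is metrized
   by the Euclidean combination of the distances, which is not the sup distance
   underlying the library's product. *)
Record is_metric (R : realType) (X : Type) (d : X -> X -> R) : Prop := {
  is_metric_ge0 : forall x y, 0 <= d x y ;
  is_metric_eq0 : forall x y, d x y = 0 <-> x = y ;
  is_metric_sym : forall x y, d x y = d y x ;
  is_metric_triangle : forall x y z, d x z <= d x y + d y z
}.

Lemma is_metric_mdist (R : realType) (M : metricType R) : is_metric (@mdist R M).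
Proof.
split; [exact: mdist_ge0 | | exact: metric_sym
  | exact: metric_triangle].
by move=> x y; split=> [/mdist_positivity//|->]; exact: mdistxx.
Qed.

(* [{i01 R}] is the type of the elements of the closed interval [0, 1]. *)
Record is_W_hyperbolic (R : realType) (X : Type) (d : X -> X -> R)
    (W : X -> X -> {i01 R} -> X) : Prop := {
  W_hyperbolic_metric : is_metric d ;
  W1 : forall (x y z : X) (l : {i01 R}),
    d z (W x y l) <= (1 - l%:num) * d z x + l%:num * d z y ;
  W2 : forall (x y : X) (l m : {i01 R}),
    d (W x y l) (W x y m) = `|l%:num - m%:num| * d x y ;
  W3 : forall (x y : X) (l : {i01 R}),
    W x y l = W y x (1 - l%:num)%:i01 ;
  W4 : forall (x y z w : X) (l : {i01 R}),
    d (W x z l) (W y w l) <= (1 - l%:num) * d x y + l%:num * d z w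
}.

Definition prod_dist (R : realType) (n : nat) (X : 'I_n -> Type)
    (d : forall i, X i -> X i -> R) (x y : forall i, X i) : R :=
  Num.sqrt (\sum_(i < n) d i (x i) (y i) ^+ 2).

Definition prod_W (R : realType) (n : nat) (X : 'I_n -> Type)
    (W : forall i, X i -> X i -> {i01 R} -> X i)
    (x y : forall i, X i) (l : {i01 R}) : forall i, X i :=
  fun i => W i (x i) (y i) l.

(* Main.v *)
Require Import Defs.
From mathcomp Require Import all_boot all_order all_algebra.
From mathcomp Require Import all_classical all_reals interval_inference.
From mathcomp Require Import ring lra.

(** The product distance is the Euclidean norm of the vector of the coordinate
    distances. Each axiom holds coordinatewise, and the inequalities survive
    the passage to the product because the Euclidean norm is monotone on
    nonnegative vectors, positively homogeneous and subadditive
    ([l2norm_le_comb]); subadditivity is Minkowski's inequality, which rests on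
    the Cauchy-Schwarz inequality ([sum_mul_sqr_le]). The triangle inequality,
    (W1) and (W4) are then instances of [l2norm_le_comb], (W2) is homogeneity
    ([l2normZ]), and (W3) holds coordinate by coordinate. *)

Import Order.TTheory GRing.Theory Num.Theory.
Local Open Scope ring_scope.

(** The Euclidean norm of a vector, so that [prod_dist d x y] is by definition
    the norm of the vector of the coordinate distances. *)
Definition l2norm {R : realType} {n : nat} (a : 'I_n -> R) : R :=
  Num.sqrt (\sum_(i < n) a i ^+ 2).

Lemma sum_sqr_ge0 (R : realType) (n : nat) (a : 'I_n -> R) :
  0 <= \sum_(i < n) a i ^+ 2.
Proof. by apply: sumr_ge0 => i _; exact: sqr_ge0. Qed.

Lemma l2norm_ge0 (R : realType) (n : nat) (a : 'I_n -> R) : 0 <= l2norm a.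
Proof. exact: sqrtr_ge0. Qed.

Lemma sqr_l2norm (R : realType) (n : nat) (a : 'I_n -> R) :
  l2norm a ^+ 2 = \sum_(i < n) a i ^+ 2.
Proof. by rewrite sqr_sqrtr ?sum_sqr_ge0. Qed.

Lemma eq_l2norm (R : realType) (n : nat) (a b : 'I_n -> R) :
  a =1 b -> l2norm a = l2norm b.
Proof. by move=> ab; congr Num.sqrt; apply: eq_bigr => i _; rewrite ab. Qed.

Lemma l2norm_eq0 (R : realType) (n : nat) (a : 'I_n -> R) :
  l2norm a = 0 <-> forall i, a i = 0.
Proof.
split=> [a0 i | a0]; last first.
  by rewrite /l2norm big1 ?sqrtr0 // => i _; rewrite a0 expr0n.
have /eqP : \sum_(j < n) a j ^+ 2 = 0 by rewrite -sqr_l2norm a0 expr0n.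
rewrite psumr_eq0 => [/allP/(_ i (mem_index_enum i))|j _]; last exact: sqr_ge0.
by rewrite /= sqrf_eq0 => /eqP.
Qed.

Lemma l2normZ (R : realType) (n : nat) (k : R) (a : 'I_n -> R) :
  0 <= k -> l2norm (fun i => k * a i) = k * l2norm a.
Proof.
move=> k0; rewrite /l2norm; under eq_bigr => i _ do rewrite exprMn.
by rewrite -mulr_sumr sqrtrM ?sqr_ge0 // sqrtr_sqr ger0_norm.
Qed.

(** The Cauchy-Schwarz inequality, from Lagrange's identity: twice the
    difference of the two sides is the sum of the squares of the
    [a i * b j - a j * b i]. *)
Lemma sum_mul_sqr_le (R : realType) (n : nat) (a b : 'I_n -> R) :
  (\sum_(i < n) a i * b i) ^+ 2 <=
  (\sum_(i < n) a i ^+ 2) * (\sum_(i < n) b i ^+ 2).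
Proof.
set S := \sum_(i < n) a i * b i.
set A := \sum_(i < n) a i ^+ 2; set B := \sum_(i < n) b i ^+ 2.
have lagrange : \sum_(i < n) \sum_(j < n) (a i * b j - a j * b i) ^+ 2 =
    A * B + B * A - 2 * (S * S).
  rewrite !big_distrlr /= mulr_sumr -big_split -sumrB /=.
  apply: eq_bigr => i _; rewrite mulr_sumr -big_split -sumrB /=.
  by apply: eq_bigr => j _; ring.
have : 0 <= A * B + B * A - 2 * (S * S).
  by rewrite -lagrange; apply: sumr_ge0 => i _; exact: sum_sqr_ge0.
by rewrite expr2; lra.
Qed.

Lemma sum_mul_le_l2norm (R : realType) (n : nat) (a b : 'I_n -> R) :
  \sum_(i < n) a i * b i <= l2norm a * l2norm b.
Proof.
rewrite /l2norm -sqrtrM ?sum_sqr_ge0 //.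
by rewrite (le_trans (ler_norm _)) // -sqrtr_sqr ler_wsqrtr ?sum_mul_sqr_le.
Qed.

(** Monotonicity, homogeneity and Minkowski's inequality in one statement: a
    nonnegative vector bounded coordinatewise by [p * a i + q * b i] has norm at
    most the same combination of the norms. The inequality is proved after
    squaring, where only the cross terms differ. *)
Lemma l2norm_le_comb (R : realType) (n : nat) (p q : R) (a b c : 'I_n -> R) :
  0 <= p -> 0 <= q -> (forall i, 0 <= c i) ->
  (forall i, c i <= p * a i + q * b i) ->
  l2norm c <= p * l2norm a + q * l2norm b.
Proof.
move=> p0 q0 c0 cab.
have rhs0 : 0 <= p * l2norm a + q * l2norm b.
  by rewrite addr_ge0 // mulr_ge0 // l2norm_ge0.
rewrite -(@ler_pXn2r _ 2) ?nnegrE ?l2norm_ge0 // sqr_l2norm.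
apply: (@le_trans _ _ (\sum_(i < n) (p * a i + q * b i) ^+ 2)).
  apply: ler_sum => i _.
  by rewrite ler_pXn2r ?nnegrE // (le_trans (c0 i) (cab i)).
have -> : \sum_(i < n) (p * a i + q * b i) ^+ 2 =
    p ^+ 2 * l2norm a ^+ 2 + q ^+ 2 * l2norm b ^+ 2 +
    2 * (p * q) * \sum_(i < n) a i * b i.
  rewrite !sqr_l2norm !mulr_sumr -!big_split /=.
  by apply: eq_bigr => i _; ring.
have -> : (p * l2norm a + q * l2norm b) ^+ 2 =
    p ^+ 2 * l2norm a ^+ 2 + q ^+ 2 * l2norm b ^+ 2 +
    2 * (p * q) * (l2norm a * l2norm b) by ring.
by rewrite lerD2l ler_wpM2l ?sum_mul_le_l2norm // !mulr_ge0.
Qed.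

Lemma is_metric_prod_dist (R : realType) (n : nat) (X : 'I_n -> Type)
    (d : forall i : 'I_n, X i -> X i -> R) :
  (forall i, is_metric (d i)) -> is_metric (prod_dist d).
Proof.
move=> hd; split=> [x y | x y | x y | x y z].
- exact: l2norm_ge0.
- apply: (iff_trans (l2norm_eq0 _ _ (fun i => d i (x i) (y i)))).
  split=> [d0 | -> i]; last by apply/(is_metric_eq0 (hd i)).
  by apply: functional_extensionality_dep => i; apply/(is_metric_eq0 (hd i)).
- by apply: eq_l2norm => i; exact: is_metric_sym.
  (* The triangle inequality is the case of weights [p = q = 1]. *)
- rewrite -[prod_dist d x y]mul1r -[prod_dist d y z]mul1r.
  apply: l2norm_le_comb => // i; first exact: is_metric_ge0.
  by rewrite !mul1r; exact: is_metric_triangle.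
Qed.

Theorem proposition3p1 (R : realType) (n : nat) (hn : (0 < n)%N)
    (X : 'I_n -> Type)
    (d : forall i : 'I_n, X i -> X i -> R)
    (W : forall i : 'I_n, X i -> X i -> {i01 R} -> X i)
    (hW : forall i : 'I_n, is_W_hyperbolic (d i) (W i)) :
  is_W_hyperbolic (prod_dist d) (prod_W W).
Proof.
have hd i : is_metric (d i) := W_hyperbolic_metric (hW i).
have l0 (l : {i01 R}) : 0 <= l%:num by [].
have l1 (l : {i01 R}) : 0 <= 1 - l%:num by rewrite subr_ge0.
split=> [| x y z l | x y l m | x y l | x y z w l].
- exact: is_metric_prod_dist.
- apply: l2norm_le_comb => // i; first exact: is_metric_ge0.
  exact: (W1 (hW i)).
- rewrite -l2normZ //; apply: eq_l2norm => i; exact: (W2 (hW i)).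
- by apply: functional_extensionality_dep => i; exact: (W3 (hW i)).
- apply: l2norm_le_comb => // i; first exact: is_metric_ge0.
  exact: (W4 (hW i)).
Qed.
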